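(* Let $$\widehat{\mathcal C}' := \Big\{\hat c : (\hat c,\hat x)\in \arg\min_{\hat c\in\mathbb R^n\setminus\{0\},\,\hat x}\Big\{\sum_{i\in\mathcal I}\sum_{j\in\mathcal J_i}\lVert x_{ij}-\hat x_i\rVert : \hat x_i\in\Big(\arg\min_{\tilde x\in\mathbb R^n}\{\hat c^{\top}\tilde x: A_i\tilde x\le b_i\}\Big)\cap\mathcal V_i\ \ \forall i\in\mathcal I\Big\}\ \text{for some } \hat x\Big\}$$ and $\widehat{\mathcal C}:=\widehat{\mathcal C}'\cup\{0\}$. Then for every $\bar c\in\mathbb R^n$ the set of optimal solutions of the problem $$\min_{\hat c}\ \lVert\bar c-\hat c\rVert_2^2\quad\text{subject to}\quad \hat c\in\widehat{\mathcal C}$$ is finite.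
   Context: $n\ge 1$. $\mathcal I$ is a finite set of experiments; experiment $i$ has inputs $A_i\in\mathbb R^{m\times n}$, $b_i\in\mathbb R^m$ such that the polyhedron $\{\tilde x\in\mathbb R^n: A_i\tilde x\le b_i\}$ is compact and nonempty; $\mathcal V_i$ denotes its set of extreme points. For each $i$, $\mathcal J_i$ is a finite set of noisy observations with observed points $x_{ij}\in\mathbb R^n$. $\lVert\cdot\rVert$ is a fixed norm on $\mathbb R^n$; $\hat x=(\hat x_i)_{i\in\mathcal I}$ with $\hat x_i\in\mathbb R^n$. The vector $\bar c$ is called the reference cost vector. *)

(* Defs.v *)
From HB Require Import structures.
From mathcomp Require Import all_boot all_order all_algebra.
From mathcomp Require Import all_classical all_reals.
From mathcomp Require Import topology normedtype.

Set Implicit Arguments.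
Unset Strict Implicit.
Unset Printing Implicit Defensive.

Import Order.TTheory GRing.Theory Num.Theory.
Import numFieldNormedType.Exports.

Local Open Scope classical_set_scope.
Local Open Scope ring_scope.

(* An arbitrary norm on R^n, not the max norm that ['cV[R]_n] carries
   canonically. Nonnegativity follows from the three axioms. *)
Definition is_norm (R : realType) (n : nat) (N : 'cV[R]_n -> R) : Prop :=
  [/\ forall x y, N (x + y) <= N x + N y,
      forall (a : R) x, N (a *: x) = `|a| * N x
    & forall x, N x = 0 -> x = 0].

Definition norm2 (R : realType) (n : nat) (x : 'cV[R]_n) : R :=
  Num.sqrt (\sum_(k < n) x k ord0 ^+ 2).

Definition dot (R : realType) (n : nat) (c x : 'cV[R]_n) : R :=
  (c^T *m x) ord0 ord0.

Definition argmin (R : realType) (T : Type) (D : set T) (f : T -> R) : set T :=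
  [set x | D x /\ forall y, D y -> f x <= f y].

Definition polyhedron (R : realType) (m n : nat)
    (A : 'M[R]_(m, n)) (b : 'cV[R]_m) : set 'cV[R]_n :=
  [set x | forall k, (A *m x) k ord0 <= b k ord0].

Definition extreme_points (R : realType) (n : nat) (S : set 'cV[R]_n) :
    set 'cV[R]_n :=
  [set x | S x /\ forall (y z : 'cV[R]_n) (t : R), S y -> S z ->
     0 < t -> t < 1 -> x = t *: y + (1 - t) *: z -> y = x /\ z = x].

Section InverseProblem.
Variables (R : realType) (m n : nat) (I : finType) (J : I -> finType).
Variables (A : I -> 'M[R]_(m, n)) (b : I -> 'cV[R]_m).
Variables (x : forall i : I, J i -> 'cV[R]_n) (N : 'cV[R]_n -> R).

Definition inverse_feasible : set ('cV[R]_n * (I -> 'cV[R]_n)) :=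
  [set p | p.1 != 0 /\
     forall i, (argmin (polyhedron (A i) (b i)) (dot p.1) `&`
                extreme_points (polyhedron (A i) (b i))) (p.2 i)].

Definition inverse_loss (p : 'cV[R]_n * (I -> 'cV[R]_n)) : R :=
  \sum_(i : I) \sum_(j : J i) N (x j - p.2 i).

Definition inverse_costs' : set 'cV[R]_n :=
  [set c | exists xhat : I -> 'cV[R]_n,
     argmin inverse_feasible inverse_loss (c, xhat)].

Definition inverse_costs : set 'cV[R]_n := inverse_costs' `|` [set 0].

End InverseProblem.

(* Main.v *)
Require Import Defs.
From HB Require Import structures.
From mathcomp Require Import all_boot all_order all_algebra.
From mathcomp Require Import all_classical all_reals.
From mathcomp Require Import topology normedtype.
From mathcomp Require Import ring lra.

(** The loss of a feasible pair [(c, xhat)] does not depend on [c].  Hence, once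
    some cost vector is optimal together with [xhat], so is every nonzero vector
    of the convex cone of costs for which each [xhat i] is a minimizer over the
    [i]-th polyhedron.  The inverse costs are therefore a union of convex cones
    indexed by tuples of vertices, together with the origin.

    In each cone there is at most one point at which the distance to [cbar] is
    the global minimum: the midpoint of two such points would be strictly
    closer ([norm2_midpoint_inj]).  There are finitely many cones, because an
    extreme point of a polyhedron is determined by the set of constraints that
    are tight there ([extreme_point_tight_inj]).  So a nonzero optimal
    solution is determined by the tight constraints of an accompanying tuple of
    vertices, for which only finitely many values exist. *)

Set Implicit Arguments.
Unset Strict Implicit.
Unset Printing Implicit Defensive.

Import Order.TTheory GRing.Theory Num.Theory.
Import numFieldNormedType.Exports.

Local Open Scope classical_set_scope.
Local Open Scope ring_scope.

Lemma finite_set_key (T : Type) (K : finType) (S : set T) (key : T -> K -> Prop) :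
  (forall c, S c -> exists k, key c k) ->
  (forall c c' k, S c -> S c' -> key c k -> key c' k -> c = c') ->
  finite_set S.
Proof.
move=> key_ex key_inj.
apply: sub_finite_set (_ : _ `<=` \bigcup_(k in [set: K]) (S `&` key^~ k)) _.
  by move=> c Sc; have [k kc] := key_ex c Sc; exists k.
apply: bigcup_finite => [|k _]; first exact: finite_finset.
have [->|/set0P[c [Sc kc]]] := eqVneq (S `&` key^~ k) set0.
  exact: finite_set0.
apply: sub_finite_set (finite_set1 c) => c' [Sc' kc'].
exact: key_inj Sc' Sc kc' kc.
Qed.

(** Used with [s] the slacks of linear constraints and [d] the rates at which
    a direction consumes them.  The inverse of one plus the sum of the ratios
    [`|d k| / s k] is a step small enough for all of them at once; the terms
    with [s k = 0] are zero and do no harm. *)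
Lemma exists_feasible_step (R : realFieldType) (K : finType) (s d : K -> R) :
  (forall k, 0 <= s k) -> (forall k, s k = 0 -> d k <= 0) ->
  exists2 e : R, 0 < e & forall k, e * d k <= s k.
Proof.
move=> s_ge0 d_le0.
pose M : R := 1 + \sum_k `|d k| / s k.
have term_ge0 k : 0 <= `|d k| / s k by rewrite divr_ge0.
have M_gt0 : 0 < M by rewrite ltr_pwDl // sumr_ge0.
exists M^-1 => [|k]; first by rewrite invr_gt0.
rewrite mulrC ler_pdivrMr //.
have [s0|s_neq0] := eqVneq (s k) 0; first by rewrite s0 mul0r d_le0.
have s_gt0 : 0 < s k by rewrite lt_def s_neq0 s_ge0.
rewrite (le_trans (ler_norm _)) // mulrC -ler_pdivrMr //.
rewrite /M (bigD1 k) //= addrCA lerDl addr_ge0 // sumr_ge0 // => i _.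
Qed.

Section Polyhedron.
Variables (R : realType) (m n : nat) (A : 'M[R]_(m, n)) (b : 'cV[R]_m).

Definition tight_rows (x : 'cV[R]_n) : {set 'I_m} :=
  [set k | (A *m x) k ord0 == b k ord0]%SET.

(** If every constraint tight at [x] is tight at [y], the segment from [y] to
    [x] can be prolonged a little beyond [x] inside the polyhedron; an extreme
    point [x] cannot be interior to such a segment unless it is degenerate. *)
Lemma extreme_point_tight_sub (x y : 'cV[R]_n) :
  extreme_points (polyhedron A b) x -> polyhedron A b y ->
  tight_rows x \subset tight_rows y -> y = x.
Proof.
move=> [Px x_ext] Py sub_tight.
have [k|k sk0|e e_gt0 e_step] :=
    @exists_feasible_step R _ (fun k => b k ord0 - (A *m x) k ord0)
                  (fun k => (A *m x) k ord0 - (A *m y) k ord0).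
- by rewrite subr_ge0; apply: Px.
- have Axk : (A *m x) k ord0 = b k ord0 by lra.
  have /(fintype.subsetP sub_tight) : k \in tight_rows x by rewrite inE Axk.
  by rewrite inE => /eqP Ayk; lra.
have Pz : polyhedron A b (x + e *: (x - y)).
  move=> k; have := e_step k.
  by rewrite mulmxDr -scalemxAr mulmxBr !mxE; lra.
have e1_gt0 : 0 < 1 + e by rewrite ltr_wpDl.
have e1_neq0 : 1 + e != 0 by rewrite gt_eqF.
(* x = t y + (1 - t) z for z = x + e (x - y) amounts to t = e (1 - t). *)
have [] // := x_ext y (x + e *: (x - y)) (e / (1 + e)) Py Pz.
- by rewrite divr_gt0.
- by rewrite ltr_pdivrMr // mul1r ltrDr.
apply/matrixP => i j; rewrite !mxE.
by field.
Qed.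

Lemma extreme_point_tight_inj (x y : 'cV[R]_n) :
  extreme_points (polyhedron A b) x -> extreme_points (polyhedron A b) y ->
  tight_rows x = tight_rows y -> x = y.
Proof.
move=> x_ext [Py _] eq_tight; apply/esym.
by apply: extreme_point_tight_sub => //; rewrite eq_tight.
Qed.

End Polyhedron.

Section Norm2.
Variables (R : realType) (n : nat).
Implicit Types u v : 'cV[R]_n.

Lemma sqr_norm2 u : norm2 u ^+ 2 = \sum_(k < n) u k ord0 ^+ 2.
Proof. by rewrite sqr_sqrtr // sumr_ge0 // => k _; apply: sqr_ge0. Qed.

(** Strict convexity of the squared norm, in the form of the parallelogram
    law: the hypothesis forces the square of [norm2 (u - v)] to vanish. *)
Lemma norm2_midpoint_inj u v :
  norm2 u ^+ 2 <= norm2 (2^-1 *: (u + v)) ^+ 2 ->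
  norm2 v ^+ 2 <= norm2 (2^-1 *: (u + v)) ^+ 2 -> u = v.
Proof.
rewrite !sqr_norm2 => leu lev.
have parallelogram : \sum_(k < n) (u k ord0 - v k ord0) ^+ 2 =
    2 * (\sum_(k < n) u k ord0 ^+ 2 + \sum_(k < n) v k ord0 ^+ 2)
    - 4 * \sum_(k < n) (2^-1 *: (u + v)) k ord0 ^+ 2.
  rewrite -big_split !mulr_sumr -sumrB; apply: eq_bigr => k _.
  by rewrite !mxE /=; field.
have sum_le0 : \sum_(k < n) (u k ord0 - v k ord0) ^+ 2 <= 0 by lra.
have sum_eq0 : \sum_(k < n) (u k ord0 - v k ord0) ^+ 2 == 0.
  by rewrite eq_le sum_le0 sumr_ge0 // => k _; apply: sqr_ge0.
apply/colP => k; apply/eqP; rewrite -subr_eq0 -sqrf_eq0.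
move: sum_eq0; rewrite psumr_eq0 => [/allP/(_ k)|i _]; last exact: sqr_ge0.
by rewrite mem_index_enum => /(_ isT).
Qed.

End Norm2.

Lemma argmin_dot_midpoint (R : realType) (n : nat) (P : set 'cV[R]_n)
    (c c' x : 'cV[R]_n) :
  argmin P (dot c) x -> argmin P (dot c') x ->
  argmin P (dot (2^-1 *: (c + c'))) x.
Proof.
move=> [Px minc] [_ minc']; split=> // y Py.
have dotE z : dot (2^-1 *: (c + c')) z = 2^-1 * (dot c z + dot c' z).
  by rewrite /dot linearZ linearD /= -scalemxAl mulmxDl !mxE.
by rewrite !dotE ler_pM2l ?invr_gt0 // lerD ?minc ?minc'.
Qed.

(** The loss ignores the cost component, so the midpoint inherits optimality
    from either pair; the adjoined origin is what makes the conclusion hold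
    also when the two costs are opposite. *)
Lemma inverse_costs_midpoint (R : realType) (m n : nat) (I : finType)
    (J : I -> finType) (A : I -> 'M[R]_(m, n)) (b : I -> 'cV[R]_m)
    (x : forall i : I, J i -> 'cV[R]_n) (N : 'cV[R]_n -> R)
    (xhat : I -> 'cV[R]_n) (c c' : 'cV[R]_n) :
  argmin (inverse_feasible A b) (inverse_loss x N) (c, xhat) ->
  inverse_feasible A b (c', xhat) ->
  inverse_costs A b x N (2^-1 *: (c + c')).
Proof.
move=> [[_ /= c_feas] opt] [_ /= c'_feas].
have [->|mid_neq0] := eqVneq (2^-1 *: (c + c')) 0; first by right.
left; exists xhat; split; last by move=> p /opt.
split=> //= i; have [minc ext] := c_feas i; have [minc' _] := c'_feas i.
by split=> //; apply: argmin_dot_midpoint.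
Qed.

Theorem theorem2 (R : realType) (m n : nat) (n_gt0 : (0 < n)%N)
    (I : finType) (J : I -> finType)
    (A : I -> 'M[R]_(m, n)) (b : I -> 'cV[R]_m)
    (x : forall i : I, J i -> 'cV[R]_n) (N : 'cV[R]_n -> R)
    (N_norm : is_norm N)
    (P_compact : forall i, compact (polyhedron (A i) (b i)))
    (P_nonempty : forall i, polyhedron (A i) (b i) !=set0)
    (cbar : 'cV[R]_n) :
  finite_set (argmin (inverse_costs A b x N)
                     (fun c => norm2 (cbar - c) ^+ 2)).
Proof.
set S := argmin _ _.
(* The origin may be an optimal solution without any tuple of vertices
   attached to it, so it is set apart. *)
suff S'_fin : finite_set (S `&` inverse_costs' A b x N).
  apply: sub_finite_set (_ : _ `<=` (S `&` inverse_costs' A b x N) `|` [set 0]) _.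
    by move=> c Sc; have [[c_opt|c0] _] := Sc; [left|right].
  by rewrite finite_setU; split=> //; apply: finite_set1.
pose key (c : 'cV[R]_n) (k : {ffun I -> {set 'I_m}}) :=
  exists2 xhat, argmin (inverse_feasible A b) (inverse_loss x N) (c, xhat) &
    k = [ffun i => tight_rows (A i) (b i) (xhat i)].
apply: (@finite_set_key _ _ _ key).
  by move=> c [_ [xhat opt]]; exists [ffun i => tight_rows (A i) (b i) (xhat i)], xhat.
move=> c c' k [[_ c_min] _] [[_ c'_min] _] [xhat opt ->] [xhat' opt' eq_key].
have xhatE : xhat = xhat'.
  apply/funext => i; have [[_ /(_ i)[_ ext]] _] := opt.
  have [[_ /(_ i)[_ ext']] _] := opt'.
  apply: extreme_point_tight_inj ext ext' _.
  by have /ffunP/(_ i) := eq_key; rewrite !ffunE.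
have mid : inverse_costs A b x N (2^-1 *: (c + c')).
  by apply: inverse_costs_midpoint opt _; rewrite xhatE; have [] := opt'.
have midE : cbar - 2^-1 *: (c + c') = 2^-1 *: ((cbar - c) + (cbar - c')).
  by apply/matrixP => i j; rewrite !mxE; field.
suff /addrI/oppr_inj : cbar - c = cbar - c' by [].
by apply: norm2_midpoint_inj; rewrite -midE; [apply: c_min|apply: c'_min].
Qed.
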